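(* Let $p$ be a monic real-rooted polynomial of degree $d$. Let $r(x)=\prod_{i=1}^d(1-\alpha_i x)$ with $\alpha_1,\dots,\alpha_d\in\mathbb{R}$, and let $D$ denote the derivative operator. If at least one $\alpha_i$ is nonzero, then $$\mathrm{Dis}(r(D)p)>\mathrm{Dis}(p).$$
   Context: For a monic polynomial $p(x)=\prod_{i=1}^d(x-\lambda_i)$ of degree $d$, the discriminant is $\mathrm{Dis}(p)=\prod_{i<j}(\lambda_i-\lambda_j)^2$. A polynomial is real-rooted if all its roots are real. $r(D)$ is the differential operator $\prod_{i=1}^d(1-\alpha_i D)$, where $D=d/dx$; $r(D)p$ is again monic of degree $d$.
   Formalization: Adds d ≥ 2 (for d = 1 both discriminants are 1) and that each root of p has multiplicity at most k+1, with k the number of nonzero α_i (otherwise both are 0, e.g. p = x³, α = (1,0,0)); exactly the failing cases are excluded. *)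

(* Defs.v *)
From mathcomp Require Import all_boot all_order all_algebra.
From mathcomp Require Import reals complex.

Set Implicit Arguments.
Unset Strict Implicit.
Unset Printing Implicit Defensive.

Import Order.TTheory GRing.Theory Num.Theory.

Local Open Scope ring_scope.
Local Open Scope complex_scope.

Section Definitions.
Variable R : realType.
Implicit Types p r : {poly R}.

Definition complexify p : {poly R[i]} := map_poly (real_complex R) p.

Definition real_rooted p : Prop :=
  forall z : R[i], root (complexify p) z -> exists x : R, z = x%:C.

(* The roots in R[i], listed with multiplicity, in an unspecified order. *)
Definition croots p : seq R[i] :=
  sval (closed_field_poly_normal (complexify p)).

(* Meant for monic p: there is no power of the leading coefficient.  The value
   does not depend on the order of the roots and is a real number, but it is
   kept in R[i]; there [x < y] means that [y - x] is a positive real. *)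
Definition Dis p : R[i] :=
  \prod_(i < size (croots p)) \prod_(j < size (croots p) | (i < j)%N)
    ((croots p)`_i - (croots p)`_j) ^+ 2.

(* r(D) p, where D is the derivative. *)
Definition diffop r p : {poly R} := \sum_(k < size r) r`_k *: p^`(k).

End Definitions.

(* Main.v *)
Require Import Defs.
From mathcomp Require Import all_boot all_order all_algebra.
From mathcomp Require Import reals complex.
From mathcomp Require Import ring zify.

(** The operator r(D) is a composition of the first-order operators 1 - a D, so
    most of the proof is about one step q = p - a p' with a <> 0 and p monic with
    real roots.

    - The roots of q are real: at a nonreal w the number P'(w)/P(w), a sum of
      terms 1/(w - x) with x real, is not real, so it cannot be 1/a
      ([Im_logderiv], [real_rooted_step]).
    - Laguerre's inequality p'^2 - p p'' > 0 off the roots of p (the sum of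
      the 1/(x - x_i)^2, times p^2, is positive; [laguerre_gt0]) shows that the
      roots of q that are not roots of p are simple, whereas a multiple root of
      p loses one unit of multiplicity ([mup_step]).
    - If p, of degree n >= 2, has simple roots, then so has q, and Dis q > Dis p
      ([disc_step]).  Put a_j = p'(y_j)/q'(y_j) for the roots y_j of q.  Laguerre's
      inequality makes the a_j positive, Lagrange interpolation of p' at the y_j
      shows that they sum to n, and computing the resultant of p and q in two
      ways shows that their product is Dis p / Dis q.  By the inequality of
      arithmetic and geometric means Dis p <= Dis q, and equality would force
      all a_j = 1, that is p' = q' and p'' = 0.

    If p has simple roots, the discriminant grows strictly at each step with
    a <> 0, and there is one.  If p has a multiple root then Dis p = 0; the m
    nonzero factors reduce multiplicities at most m + 1 to 1, so the
    result has simple real roots and a positive discriminant. *)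

Set Implicit Arguments.
Unset Strict Implicit.
Unset Printing Implicit Defensive.

Import Order.TTheory GRing.Theory Num.Theory.
Local Open Scope ring_scope.

Local Notation rootpoly s := (\prod_(z <- s) ('X - z%:P)).
Local Notation step a p := (p - a *: p^`()).

(** * Roots, derivatives and the discriminant over a field *)

Lemma prodr_const_seq (R : pzSemiRingType) (I : Type) (r : seq I) (x : R) :
  \prod_(i <- r) x = x ^+ size r.
Proof. by rewrite big_const_seq count_predT iter_mulr_1. Qed.

Section Field.
Variable F : fieldType.
Implicit Types (s t : seq F) (p q f : {poly F}).

(** The discriminant of a list of roots in any field; [Dis p] unfolds to
    [disc (croots p)]. *)
Definition disc s : F :=
  \prod_(i < size s) \prod_(j < size s | (i < j)%N) (s`_i - s`_j) ^+ 2.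

(** The sign (-1)^(n(n-1)/2) by which the product of the derivatives at the
    roots differs from the discriminant.  Only its dependence on n alone
    matters, so it is left as a product over pairs. *)
Definition pair_sign n : F := \prod_(i < n) \prod_(j < n | (i < j)%N) -1.

Lemma pair_sign_neq0 n : pair_sign n != 0.
Proof.
apply/prodf_neq0 => i _; apply/prodf_neq0 => j _.
by rewrite oppr_eq0 oner_neq0.
Qed.

Lemma rootpoly_ord s : rootpoly s = \prod_(i < size s) ('X - (s`_i)%:P).
Proof. by rewrite (big_nth 0) big_mkord. Qed.

Lemma deriv_rootpoly s (i : 'I_(size s)) :
  (rootpoly s)^`().[s`_i] = \prod_(j < size s | j != i) (s`_i - s`_j).
Proof.
rewrite rootpoly_ord (bigD1 i) //= derivM !hornerE derivXsubC hornerC mul1r.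
rewrite subrr mul0r addr0 horner_prod.
by apply: eq_bigr => j _; rewrite !hornerE.
Qed.

(** At s_i the derivative is the product of the s_i - s_j over all j other
    than i, so over all i each unordered pair contributes
    (s_i - s_j)(s_j - s_i) = - (s_i - s_j)^2.  The left side is symmetric in the
    roots, which frees the discriminant from their order. *)
Lemma prod_deriv_rootpoly s :
  \prod_(z <- s) (rootpoly s)^`().[z] = pair_sign (size s) * disc s.
Proof.
rewrite (big_nth 0) big_mkord (eq_bigr _ (fun i _ => deriv_rootpoly i)).
pose low := \prod_(i < size s) \prod_(j < size s | (j < i)%N) (s`_i - s`_j).
pose up := \prod_(i < size s) \prod_(j < size s | (i < j)%N) (s`_i - s`_j).
have -> : \prod_(i < size s) \prod_(j < size s | j != i) (s`_i - s`_j)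
    = up * low.
  rewrite -big_split /=; apply: eq_bigr => i _.
  rewrite (bigID (fun j : 'I__ => (i < j)%N)) /=; congr (_ * _);
    by apply: eq_bigl => j; rewrite -val_eqE /=; case: ltngtP.
have -> : low = pair_sign (size s) * up.
  rewrite /low (exchange_big_dep xpredT) //= -big_split /=.
  apply: eq_bigr => i _; rewrite -big_split /=.
  by apply: eq_bigr => j _; rewrite mulN1r opprB.
rewrite mulrCA; congr (_ * _); rewrite -big_split /=; apply: eq_bigr => i _.
by rewrite -big_split /=; apply: eq_bigr => j _; rewrite expr2.
Qed.

Lemma perm_disc {s t} : perm_eq s t -> disc s = disc t.
Proof.
move=> st; apply: (mulfI (pair_sign_neq0 (size s))).
rewrite -prod_deriv_rootpoly (perm_size st) -prod_deriv_rootpoly.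
by rewrite (perm_big _ st) /= (perm_big _ st).
Qed.

Lemma disc_eq0 s : (disc s == 0) = ~~ uniq s.
Proof.
apply/idP/idP => [/prodf_eq0[i _ /prodf_eq0[j ltij]]|/(uniqPn 0)[i [j [ij js sij]]]].
  rewrite expf_eq0 /= subr_eq0 => /eqP sij; apply/(uniqPn 0).
  by exists i, j; split.
apply/prodf_eq0; exists (Ordinal (ltn_trans ij js)) => //.
by apply/prodf_eq0; exists (Ordinal js) => //=; rewrite sij subrr expr0n.
Qed.

Lemma deriv_rootpoly_neq0 s z :
  uniq s -> z \in s -> (rootpoly s)^`().[z] != 0.
Proof.
move=> us /(nthP 0)[k ks <-].
rewrite (deriv_rootpoly (Ordinal ks)); apply/prodf_neq0 => j ji.
by rewrite subr_eq0 nth_uniq // eq_sym.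
Qed.

Lemma poly_eq0_on_roots s f :
  uniq s -> (size f <= size s)%N -> {in s, forall z, f.[z] = 0} -> f = 0.
Proof.
move=> us szf fs; apply/eqP; apply: contraTT szf => f_neq0.
rewrite -ltnNge; apply: max_poly_roots => //.
by apply/allP => z zs; apply/eqP/fs.
Qed.

(** Compare coefficients of degree n-1, n = size s, in Lagrange's formula
    for P = prod_i (X - s_i),
    f = sum_i f(s_i)/P'(s_i) * P/(X - s_i): each P/(X - s_i) is monic of degree
    n-1. *)
Lemma sum_lagrange s f :
  uniq s -> (size f <= size s)%N ->
  \sum_(z <- s) f.[z] / (rootpoly s)^`().[z] = f`_(size s).-1.
Proof.
move=> us szf.
pose N (i : 'I_(size s)) := \prod_(j < size s | j != i) ('X - (s`_j)%:P).
have N_monic i : N i \is monic.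
  by apply: monic_prod => j _; apply: monicXsubC.
have szN i : size (N i) = size s.
  apply: succn_inj; rewrite -(size_prod_XsubC s id) rootpoly_ord (bigD1 i) //=.
  by rewrite size_monicM ?monicXsubC ?monic_neq0 ?N_monic // size_XsubC.
have topN i : (N i)`_(size s).-1 = 1.
  by rewrite -(szN i) -lead_coefE (monicP (N_monic i)).
have dN (i : 'I_(size s)) : (N i).[s`_i] = (rootpoly s)^`().[s`_i].
  by rewrite deriv_rootpoly horner_prod; apply: eq_bigr => j _; rewrite !hornerE.
have NV (i j : 'I_(size s)) : j != i -> (N i).[s`_j] = 0.
  by move=> ji; rewrite horner_prod (bigD1 j) //= !hornerE subrr mul0r.
have dN_neq0 (i : 'I_(size s)) : (rootpoly s)^`().[s`_i] != 0.
  by rewrite deriv_rootpoly_neq0 ?mem_nth.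
pose c (i : 'I_(size s)) := f.[s`_i] / (rootpoly s)^`().[s`_i].
have fE : f = \sum_i c i *: N i.
  apply/eqP; rewrite -subr_eq0; apply/eqP; apply: (@poly_eq0_on_roots s) => //.
    rewrite (leq_trans (size_polyD _ _)) // size_polyN geq_max szf /=.
    apply: leq_trans (size_sum _ _ _) _; apply/bigmax_leqP => i _.
    by rewrite (leq_trans (size_scale_leq _ _)) ?szN.
  move=> z /(nthP 0)[k ks <-]; pose i := Ordinal ks.
  rewrite hornerD hornerN horner_sum (bigD1 i) //= big1 => [|j ji].
    by rewrite hornerZ (dN i) divfK ?dN_neq0 // addr0 subrr.
  by rewrite hornerZ (NV j i) ?mulr0 // eq_sym.
rewrite [in RHS]fE coef_sum (big_nth 0) big_mkord; apply: eq_bigr => i _.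
by rewrite coefZ topN mulr1.
Qed.
End Field.

Lemma disc_map (F K : fieldType) (h : {rmorphism F -> K}) (s : seq F) :
  disc [seq h z | z <- s] = h (disc s).
Proof.
rewrite /disc size_map rmorph_prod; apply: eq_bigr => i _.
rewrite rmorph_prod; apply: eq_bigr => j _.
by rewrite !(nth_map 0) // rmorphXn rmorphB.
Qed.

(** * One factor 1 - a D over an ordered field *)

Section Ordered.
Variable F : realFieldType.
Implicit Types (s t : seq F) (p q f : {poly F}) (a x : F).

Lemma disc_gt0 s : (0 < disc s) = uniq s.
Proof.
rewrite lt_def disc_eq0 negbK andb_idr // => _.
by apply: prodr_ge0 => i _; apply: prodr_ge0 => j _; apply: sqr_ge0.
Qed.

(** With p = prod_i (X - s_i), this is p^2 * sum_i 1/(X - s_i)^2, that is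
    -p^2 (p'/p)'; in this form it also makes sense at the roots of p. *)
Definition laguerre p : {poly F} := p^`() ^+ 2 - p * p^`()^`().

Lemma laguerre_XsubC x f (z : F) :
  (laguerre (('X - z%:P) * f)).[x] = f.[x] ^+ 2 + (x - z) ^+ 2 * (laguerre f).[x].
Proof.
rewrite /laguerre derivM derivXsubC mul1r derivD derivM derivXsubC mul1r !hornerE.
rewrite /=; ring.
Qed.

Lemma laguerre_ge0 s x : 0 <= (laguerre (rootpoly s)).[x].
Proof.
elim: s => [|z s IH].
  by rewrite big_nil /laguerre -polyC1 !derivC !hornerE expr2 mul0r subrr.
rewrite big_cons laguerre_XsubC.
by rewrite addr_ge0 ?sqr_ge0 // mulr_ge0 ?sqr_ge0.
Qed.

Lemma laguerre_gt0 s x : s != [::] -> ~~ root (rootpoly s) x ->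
  0 < (laguerre (rootpoly s)).[x].
Proof.
case: s => // z s _; rewrite big_cons laguerre_XsubC rootM negb_or => /andP[_ sx].
apply: ltr_wpDr; first by apply: mulr_ge0; [apply: sqr_ge0|apply: laguerre_ge0].
by rewrite exprn_even_gt0 /= -?rootE.
Qed.

Lemma size_step a p : size (step a p) = size p.
Proof.
have [->|p0] := eqVneq p 0; first by rewrite deriv0 scaler0 subr0.
rewrite size_polyDl // size_polyN (leq_ltn_trans (size_scale_leq _ _)) //.
exact: lt_size_deriv.
Qed.

Lemma monic_step a p : p \is monic -> step a p \is monic.
Proof.
move=> pm; rewrite monicE lead_coefDl ?(monicP pm) //.
rewrite size_polyN (leq_ltn_trans (size_scale_leq _ _)) //.
exact/lt_size_deriv/monic_neq0.
Qed.

(** A root of p of multiplicity m+1 becomes one of multiplicity m, since p' has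
    multiplicity m there.  A root x of q = p - a p' with p(x) <> 0 is simple:
    from q(x) = q'(x) = 0 one gets p = a p' and p' = a p'' at x, so that
    p'^2 - p p'' vanishes there, against Laguerre's inequality. *)
Lemma mup_step a s x : a != 0 -> s != [::] ->
  (mup x (step a (rootpoly s)) <= maxn 1 (mup x (rootpoly s)).-1)%N.
Proof.
move=> a0 s0; set p := rootpoly s.
have pm : p \is monic by apply: monic_prod_XsubC.
have qn0 : step a p != 0 by apply/monic_neq0/monic_step.
have [px|npx] := boolP (root p x).
  have [m [r]] := multiplicity_XsubC p x.
  rewrite monic_neq0 //= => rx pE.
  case: m pE => [|m] pE; first by rewrite pE expr0 mulr1 (negbTE rx) in px.
  have -> : mup x p = m.+1 by rewrite pE mupMr // mup_XsubCX eqxx.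
  suff -> : mup x (step a p) = m by rewrite leq_maxr.
  have -> : step a p = (('X - x%:P) * (r - a *: r^`()) - a *+ m.+1 *: r) *
                       ('X - x%:P) ^+ m.
    rewrite pE derivM deriv_exp derivXsubC mul1r /= -!mul_polyC polyCMn exprS.
    rewrite -[_ *+ m.+1 in LHS]mulr_natr -[_ *+ m.+1 in RHS]mulr_natr.
    by move: _%:P (_ ^+ m) (m.+1%:R) => u v w; ring.
  rewrite mupMr ?mup_XsubCX ?eqxx // rootE !hornerE subrr mul0r add0r.
  by rewrite oppr_eq0 mulf_neq0 // mulrn_eq0.
apply: leq_trans (leq_maxl _ _); rewrite mup_leq //.
apply/negP => /dvdpP[r qE].
have q0 : (step a p).[x] = 0 by rewrite qE expr2 mulrA hornerM hornerXsubC subrr mulr0.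
have q1 : (step a p)^`().[x] = 0.
  rewrite qE expr2 mulrA derivM derivXsubC mulr1 hornerD !hornerM hornerXsubC.
  by rewrite subrr !mulr0 addr0.
have := laguerre_gt0 s0 npx; rewrite -/p /laguerre.
move: q0 q1; rewrite !derivE !hornerE => /subr0_eq-> /subr0_eq->.
by rewrite expr2 mulrAC mulrA subrr ltxx.
Qed.

Lemma uniq_mup s : (forall x, (mup x (rootpoly s) <= 1)%N) -> uniq s.
Proof.
move=> s1; apply: count_mem_uniq => x; have := s1 x; rewrite mu_prod_XsubC.
have [xs|/count_memPn->//] := boolP (x \in s).
by rewrite leq_eqVlt ltnS leqn0 => /orP[/eqP->//|/eqP/count_memPn]; rewrite xs.
Qed.

(** The ratios p'/q' at the roots of q = p - a p' are positive by Laguerre's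
    inequality, sum to n = deg p by Lagrange interpolation of p', and have product
    disc p / disc q, because the products of p' over the roots of p and over
    those of q agree.  The inequality of arithmetic and geometric means
    gives disc p <= disc q; equality would make all ratios 1, hence p' = q' at the
    n roots of q, so a p'' = 0, which is excluded by n >= 2. *)
Lemma disc_step a s t : a != 0 -> (1 < size s)%N -> uniq s -> uniq t ->
  step a (rootpoly s) = rootpoly t -> disc s < disc t.
Proof.
move=> a0 s2 us ut qE; set p := rootpoly s in qE; set q := rootpoly t in qE.
have szst : size t = size s.
  by apply: succn_inj; rewrite -!(size_prod_XsubC _ id) -/p -/q -qE size_step.
have sn0 : s != [::] by case: (s) s2.
have pm : p \is monic by apply: monic_prod_XsubC.
have dp_size : (size p^`() <= size t)%N.
  by rewrite -ltnS szst -(size_prod_XsubC s id) lt_size_deriv // monic_neq0.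
have pt z : z \in t -> p.[z] = a * p^`().[z].
  rewrite -root_prod_XsubC -/q -qE => /eqP.
  by rewrite !hornerE => /subr0_eq.
have ratio_gt0 z : z \in t -> 0 < p^`().[z] / q^`().[z].
  move=> zt; have npz : ~~ root p z.
    apply/negP => pz; have := pt z zt; rewrite (eqP pz) => /esym/eqP.
    rewrite mulf_eq0 (negbTE a0) /= (negbTE (deriv_rootpoly_neq0 _ _)) //.
    by rewrite -root_prod_XsubC.
  have q'z : q^`().[z] != 0 by rewrite deriv_rootpoly_neq0.
  (* As p = a p' at z, the product p' q' = p'^2 - a p' p'' is the Laguerre
     expression p'^2 - p p'' at z. *)
  suff dpq : 0 < p^`().[z] * q^`().[z].
    have -> : p^`().[z] / q^`().[z] = p^`().[z] * q^`().[z] / q^`().[z] ^+ 2.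
      by field.
    by rewrite divr_gt0 // exprn_even_gt0.
  have := laguerre_gt0 sn0 npz; rewrite -/p /laguerre -qE.
  rewrite !derivE !hornerE pt // => /lt_le_trans; apply.
  by rewrite le_eqVlt; apply/orP; left; apply/eqP; ring.
have sum_ratio : \sum_(z <- t) p^`().[z] / q^`().[z] = (size t)%:R.
  rewrite sum_lagrange // coef_deriv szst prednK ?(ltnW s2) //.
  have -> : size s = (size p).-1 by rewrite size_prod_XsubC.
  by rewrite -lead_coefE (monicP pm).
(* Both sides are read off the resultant of p and q: p = a p' at the roots of
   q, and q = - a p' at the roots of p. *)
have resultant : \prod_(z <- t) p^`().[z] = \prod_(y <- s) p^`().[y].
  have ast : a ^+ size s * \prod_(z <- t) p^`().[z] =
             \prod_(y <- s) \prod_(z <- t) (z - y).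
    rewrite -szst -prodr_const_seq exchange_big /= -big_split /=.
    rewrite !big_seq; apply: eq_bigr => z zt; rewrite -pt // horner_prod.
    by apply: eq_bigr => y _; rewrite !hornerE.
  have ass : (- a) ^+ size s * \prod_(y <- s) p^`().[y] =
             \prod_(y <- s) \prod_(z <- t) (y - z).
    rewrite -prodr_const_seq -big_split /=.
    rewrite !big_seq; apply: eq_bigr => y ys.
    transitivity q.[y].
      rewrite -qE !hornerE (eqP (_ : root p y)) ?root_prod_XsubC //; ring.
    by rewrite horner_prod; apply: eq_bigr => z _; rewrite !hornerE.
  (* There are n^2 sign changes, and n^2 has the parity of n, so that this
     sign cancels the one of (- a)^n. *)
  have sgn : \prod_(y <- s) \prod_(z <- t) (y - z) =
             (-1) ^+ size s * \prod_(y <- s) \prod_(z <- t) (z - y).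
    transitivity (\prod_(y <- s) ((-1) ^+ size s * \prod_(z <- t) (z - y))).
      apply: eq_bigr => y _; rewrite -szst -prodr_const_seq -big_split /=.
      by apply: eq_bigr => z _; rewrite mulN1r opprB.
    rewrite big_split /= prodr_const_seq -exprM.
    by rewrite -[in LHS]signr_odd oddM andbb signr_odd.
  have sgn_neq0 : (-1) ^+ size s != 0 :> F by rewrite signr_eq0.
  have a_neq0 : a ^+ size s != 0 by rewrite expf_neq0.
  apply/esym/(mulfI a_neq0)/(mulfI sgn_neq0).
  by rewrite mulrA -exprNn ass sgn ast.
pose E (i : 'I_(size t)) := p^`().[t`_i] / q^`().[t`_i].
have prodE : \prod_i E i = disc s / disc t.
  transitivity (\prod_(z <- t) (p^`().[z] / q^`().[z])).
    by rewrite (big_nth 0) big_mkord.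
  rewrite prodf_div resultant !prod_deriv_rootpoly szst.
  by rewrite -mulf_div divff ?mul1r ?pair_sign_neq0.
have sumE : \sum_i E i = (size t)%:R.
  by rewrite -sum_ratio (big_nth 0) big_mkord.
have E_ge0 : {in predT, forall i, 0 <= E i}.
  by move=> i _; rewrite ltW // ratio_gt0 // mem_nth.
have t0 : (size t)%:R != 0 :> F by rewrite pnatr_eq0 szst -lt0n ltnW.
have /lt_leif := leif_AGM E_ge0.
rewrite card_ord prodE sumE divff // expr1n ltr_pdivrMr ?disc_gt0 // mul1r => ->.
apply/negP => /forall_inP Econst.
have E1 i : E i = 1.
  apply: (mulfI t0); rewrite mulr1 -[RHS]sumE.
  transitivity (\sum_(j < size t) E i).
    by rewrite sumr_const card_ord mulr_natl.
  by apply: eq_bigr => j _; have /forall_inP/(_ j isT)/eqP := Econst i isT.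
have ddp : p^`()^`() = 0.
  apply: (poly_eq0_on_roots ut).
    apply: leq_trans dp_size; have [->|dp0] := eqVneq p^`() 0.
      by rewrite deriv0.
    exact/ltnW/lt_size_deriv.
  move=> z /(nthP 0)[k kt <-].
  have := E1 (Ordinal kt); rewrite /E /= => /divr1_eq.
  rewrite -qE derivB derivZ hornerD hornerN hornerZ => /eqP.
  by rewrite -subr_eq0 opprB addrC subrK mulf_eq0 (negbTE a0) /= => /eqP.
have [n nE] : exists n, size s = n.+2.
  by exists (size s - 2)%N; rewrite -addn2 subnK.
have := congr1 (fun f : {poly F} => f`_n) ddp.
rewrite /= coef0 !coef_deriv -nE.
have -> : p`_(size s) = 1.
  have -> : size s = (size p).-1 by rewrite size_prod_XsubC.
  by rewrite -lead_coefE (monicP pm).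
by move=> /eqP; rewrite -mulrnA pnatr_eq0 muln_eq0 nE.
Qed.
End Ordered.

(** * Real-rootedness and the operator r(D) *)

Section Operator.
Variable R : realType.
Implicit Types (p r : {poly R}) (a : R) (s t : seq R).

(** A bound independent of r makes the sum additive in r. *)
Lemma diffop_widen n r p : (size r <= n)%N ->
  diffop r p = \sum_(k < n) r`_k *: p^`(k).
Proof.
move=> rn; rewrite /diffop (big_ord_widen _ (fun k => r`_k *: p^`(k)) rn).
rewrite big_mkcond /=; apply: eq_bigr => k _.
by case: ltnP => // ?; rewrite nth_default ?scale0r.
Qed.

Lemma diffop1 p : diffop 1 p = p.
Proof. by rewrite /diffop size_poly1 big_ord1 coef1 scale1r. Qed.

Lemma diffop_factor a r p :
  diffop ((1 - a *: 'X) * r) p = step a (diffop r p).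
Proof.
have rE : (1 - a *: 'X) * r = r - a *: ('X * r).
  by rewrite mulrBl mul1r scalerAl.
have szX : (size ('X * r)%R <= (size r).+1)%N.
  by rewrite mulrC; have [->|r0] := eqVneq r 0; rewrite ?mul0r ?size_poly0 ?size_mulX.
have -> : diffop ((1 - a *: 'X) * r) p =
          \sum_(k < (size r).+1) (r - a *: ('X * r))`_k *: p^`(k).
  rewrite rE; apply: diffop_widen; rewrite (leq_trans (size_polyD _ _)) //.
  by rewrite size_polyN geq_max leqnSn (leq_trans (size_scale_leq _ _)).
under eq_bigr => k _ do rewrite coefB coefZ scalerBl -scalerA.
rewrite sumrB -(diffop_widen _ (leqnSn _)); congr (_ - _).
rewrite -scaler_sumr; congr (_ *: _).
rewrite big_ord_recl coefXM /= scale0r add0r /diffop raddf_sum.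
by apply: eq_bigr => k _; rewrite /bump coefXM /= derivZ.
Qed.

Lemma complexify_croots p : p \is monic -> complexify p = rootpoly (croots p).
Proof.
move=> pm; rewrite {1}[complexify p](svalP (closed_field_poly_normal _)).
rewrite -/(croots p).
by rewrite lead_coef_map (monicP pm) rmorph1 scale1r.
Qed.

Lemma real_rooted_rootpoly p : p \is monic -> real_rooted p ->
  exists s, p = rootpoly s.
Proof.
move=> pm prr; have pE := complexify_croots pm.
exists [seq complex.Re z | z <- croots p].
apply: (map_poly_inj (real_complex R)); rewrite -/(complexify p) pE.
rewrite rmorph_prod big_map !big_seq; apply: eq_bigr => z zrs /=.
have [x ->] : exists x : R, z = x%:C%C.
  by apply: prr; rewrite pE root_prod_XsubC.
by rewrite map_polyXsubC.
Qed.

Lemma complexify_rootpoly s :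
  complexify (rootpoly s) = rootpoly [seq x%:C%C | x <- s].
Proof.
rewrite /complexify rmorph_prod big_map.
by apply: eq_bigr => x _; rewrite /= map_polyXsubC.
Qed.

Lemma Dis_rootpoly s : Dis (rootpoly s) = (disc s)%:C%C.
Proof.
have pm : rootpoly s \is monic by apply: monic_prod_XsubC.
have pE : rootpoly [seq x%:C%C | x <- s] = rootpoly (croots (rootpoly s)).
  by rewrite -complexify_croots // complexify_rootpoly.
rewrite -[Dis _]/(disc (croots (rootpoly s))).
by rewrite -(perm_disc (prod_XsubC_eq pE)) (disc_map (real_complex R)).
Qed.

(** P'/P is the sum of the 1/(w - x) over the real roots x, and each term has
    imaginary part of sign opposite to that of w.  Multiplying by |P(w)|^2 avoids
    the division and lets the induction add one root at a time. *)
Lemma Im_logderiv s (w : R[i]) : complex.Im w != 0 -> s != [::] ->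
  let P := rootpoly [seq x%:C%C | x <- s] in
  P.[w] != 0 /\
  (complex.Im (P^`().[w] * conjc P.[w]) * complex.Im w < 0).
Proof.
move=> w0; elim: s => // z s IH _ /=; rewrite big_cons.
set G := rootpoly _.
have Gw : G.[w] != 0 /\
   (complex.Im (G^`().[w] * conjc G.[w]) * complex.Im w <= 0).
  have [sE|sn] := eqVneq s [::].
    rewrite /G sE big_nil -polyC1 derivC !hornerE oner_eq0.
    by split=> //=; rewrite ?mul0r.
  by have [? /ltW] := IH sn.
case: Gw => Gn GI; split.
  rewrite hornerM mulf_neq0 // hornerXsubC subr_eq0.
  by apply: contra w0 => /eqP->.
move: Gn GI; rewrite derivM derivXsubC mul1r hornerD !hornerM hornerXsubC.
move: {IH} w0 G.[w] (G^`().[w]); case: w => u v /= v0 [g h] [k l].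
rewrite eq_complex /= negb_and => gh GI.
(* With c = w - z, A = G(w) and B = G'(w), the imaginary part of
   (A + c B) conj(c A) is - Im w |A|^2 + |c|^2 Im (B conj(A)). *)
have n_gt0 : 0 < v ^+ 2 * (g ^+ 2 + h ^+ 2).
  rewrite mulr_gt0 ?exprn_even_gt0 //= lt_def addr_ge0 ?sqr_ge0 // andbT.
  by rewrite paddr_eq0 ?sqr_ge0 // !sqrf_eq0 negb_and.
have c_ge0 : 0 <= (u - z) ^+ 2 + v ^+ 2 by rewrite addr_ge0 ?sqr_ge0.
have := mulr_ge0_le0 c_ge0 GI => /le_lt_trans/(_ n_gt0).
rewrite -subr_lt0; congr (_ < 0); ring.
Qed.

(** At a nonreal root w of p - a p' one has P = a P', so P' times the conjugate
    of P is a |P'|^2, which is real, against [Im_logderiv]. *)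
Lemma real_rooted_step a s : exists t, step a (rootpoly s) = rootpoly t.
Proof.
have [->|s0] := eqVneq s [::].
  by exists [::]; rewrite big_nil -polyC1 derivC scaler0 subr0.
apply: real_rooted_rootpoly; first exact/monic_step/monic_prod_XsubC.
move=> w; rewrite /complexify rmorphB /= map_polyZ -deriv_map.
rewrite -/(complexify _) complexify_rootpoly rootE hornerD hornerN hornerZ.
rewrite subr_eq0 => /eqP Pw.
have [w0|/(Im_logderiv)/(_ s0)[_]] := eqVneq (complex.Im w) 0.
  by exists (complex.Re w); case: w w0 {Pw} => u v /= ->.
rewrite Pw; case: (_^`().[w]) => k l /=.
have -> : k * - (a * l + 0 * k) + l * (a * k - 0 * l) = 0 by ring.
by rewrite mul0r ltxx.
Qed.

Definition nonzeros (l : seq R) := count (fun a => a != 0) l.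

(** The factors are applied one at a time.  The multiplicity bound does two
    jobs: simple roots stay simple, which the next discriminant step needs, and
    enough nonzero factors make all roots simple whatever p is. *)
Lemma diffop_rootpoly (l s : seq R) : (1 < size s)%N ->
  exists t, [/\ diffop (\prod_(a <- l) (1 - a *: 'X)) (rootpoly s) = rootpoly t,
    size t = size s,
    forall x, (mup x (rootpoly t) <=
               maxn 1 (mup x (rootpoly s) - nonzeros l))%N,
    uniq s -> disc s <= disc t
  & uniq s -> (0 < nonzeros l)%N -> disc s < disc t].
Proof.
move=> s2; elim: l => [|a l [t [tE tsz tm tle tlt]]].
  exists s; rewrite big_nil diffop1; split=> // x.
  by rewrite subn0 leq_maxr.
rewrite big_cons diffop_factor tE /nonzeros /= -/(nonzeros l).
have [->|a0] := eqVneq a 0.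
  by exists t; rewrite scale0r subr0.
have t0 : t != [::] by rewrite -size_eq0 tsz; case: (size s) s2.
have [u uE] := real_rooted_step a t.
have um x : (mup x (rootpoly u) <= maxn 1 (mup x (rootpoly s) - (1 + nonzeros l)))%N.
  rewrite -uE (leq_trans (mup_step _ a0 t0)) // geq_max leq_maxl /=.
  by move: (tm x); move: (mup x _) (mup x _) (nonzeros l) => m n c; lia.
have slt : uniq s -> disc s < disc u.
  move=> us; have smup x : (mup x (rootpoly s) <= 1)%N.
    by rewrite mu_prod_XsubC count_uniq_mem ?leq_b1.
  have ut : uniq t.
    apply: uniq_mup => x; move: (tm x) (smup x).
    by move: (mup x _) (mup x _) (nonzeros l) => *; lia.
  have uu : uniq u.
    apply: uniq_mup => x; move: (um x) (smup x).
    by move: (mup x _) (mup x _) (nonzeros l) => *; lia.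
  by apply: le_lt_trans (tle us) (disc_step a0 _ ut uu uE); rewrite tsz.
exists u; split=> //; [|by move=> /slt/ltW|by move=> /slt].
by apply: succn_inj; rewrite -tsz -!(size_prod_XsubC _ id) /= -uE size_step.
Qed.
End Operator.

Theorem corollary1p1 (R : realType) (d : nat) (p : {poly R}) (alpha : 'I_d -> R)
  (hd : (2 <= d)%N)
  (p_monic : p \is monic)
  (p_deg : size p = d.+1)
  (p_rr : real_rooted p)
  (alpha_neq0 : exists i : 'I_d, alpha i != 0)
  (p_mult : forall x : R, (mup x p <= #|[set i : 'I_d | (alpha i != 0)%R]|.+1)%N) :
  Dis (diffop (\prod_(i < d) (1 - alpha i *: 'X)) p) > Dis p.
Proof.
have [s pE] := real_rooted_rootpoly p_monic p_rr.
have szs : size s = d by apply: succn_inj; rewrite -p_deg pE size_prod_XsubC.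
pose l := [seq alpha i | i <- index_enum 'I_d].
have lE : nonzeros l = #|[set i : 'I_d | (alpha i != 0)%R]|.
  rewrite /nonzeros count_map cardsE cardE /enum_mem size_filter; exact: eq_count.
have s2 : (1 < size s)%N by rewrite szs.
have [t [tE _ tm _ tlt]] := diffop_rootpoly l s2.
have -> : \prod_(i < d) (1 - alpha i *: 'X) = \prod_(a <- l) (1 - a *: 'X).
  by rewrite big_map.
rewrite pE tE !Dis_rootpoly ltcR.
have [us|nus] := boolP (uniq s).
  apply: tlt => //; rewrite lE card_gt0.
  by have [i ai] := alpha_neq0; apply/set0Pn; exists i; rewrite inE.
(* With a multiple root Dis p = 0, and it suffices that the image has
   simple roots; this is where the bound on the multiplicities enters. *)
have /eqP-> : disc s == 0 by rewrite disc_eq0.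
rewrite disc_gt0; apply: uniq_mup => x.
have := tm x; have := p_mult x; rewrite -lE pE.
move: (mup x _) (mup x _) (nonzeros l) => *; lia.
Qed.
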